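(* Let $\Gamma \subset \mathbb{H} \rtimes S^1$ be a Heisenberg Bieberbach group satisfying $\mathrm{pr}_2(\Gamma) = \langle -1 \rangle$. Put $\Lambda = \Gamma \cap \mathbb{H}$ and $N = \#(Z(\Lambda)/[\Lambda,\Lambda])$. Then $N$ must be even, and there exists $\tau \in \mathbb{C}$ with $\operatorname{Im}\tau > 0$ such that $\Gamma$ is conjugate in $\mathbb{H} \rtimes \mathbb{C}^*$ to $$\Gamma_{\tau,c} := \langle \Lambda_{\tau,c},\ \varphi := (0, c/2)\,\mu(-1) \rangle, \qquad \text{where } c = \frac{4 \operatorname{Im}\tau}{N}.$$
   Context: The Heisenberg group is $\mathbb{H} = \mathbb{C}\times\mathbb{R}$ with multiplication $(z,t)\cdot(z',t') = (z+z', t+t'+2\operatorname{Im}(z\bar z'))$. For $\lambda \in \mathbb{C}^*$ let $\mu(\lambda)(z,t) = (\lambda z, |\lambda|^2 t)$. The group $\mathbb{H}\rtimes\mathbb{C}^*$ is the set $\mathbb{H}\times\mathbb{C}^*$ with $(g,\lambda)\cdot(h,\nu) = (g\cdot\mu(\lambda)(h), \lambda\nu)$; it acts on $\mathbb{H}$ from the left by $(g,\lambda)h = g\cdot\mu(\lambda)(h)$, and $(g,\lambda)$ is also written $g\,\mu(\lambda)$. $\mathbb{H}$ is regarded as the subgroup of elements $(g,1)$, $\mathbb{H}\rtimes S^1$ is the subgroup of elements $(g,\lambda)$ with $|\lambda|=1$, and $\mathrm{pr}_2: \mathbb{H}\rtimes\mathbb{C}^*\to\mathbb{C}^*$ is the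 second projection. A Heisenberg Bieberbach group is a discrete torsion-free subgroup $\Gamma\subset\mathbb{H}\rtimes S^1$ such that $\Gamma\backslash\mathbb{H}$ is compact; then $\Lambda=\Gamma\cap\mathbb{H}$ is a lattice (co-compact discrete subgroup) in $\mathbb{H}$, and $Z(\Lambda)/[\Lambda,\Lambda]$ is finite, where $Z(\Lambda)$ denotes the center and $[\Lambda,\Lambda]$ the commutator subgroup. For $\tau\in\mathbb{C}$ and $c>0$ with $4\operatorname{Im}\tau/c\in\mathbb{Z}_{>0}$, $\Lambda_{\tau,c} := \langle (1,0),(\tau,0),(0,c)\rangle \subset \mathbb{H}$. Angle brackets denote the subgroup generated. *)

(* Defs.v *)
From HB Require Import structures.
From mathcomp Require Import all_boot all_order all_algebra.
From mathcomp Require Import finmap generic_quotient complex ring.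
From mathcomp Require Import all_classical all_reals topology.

Set Implicit Arguments.
Unset Strict Implicit.
Unset Printing Implicit Defensive.

Import Order.TTheory GRing.Theory Num.Theory.
Local Open Scope classical_set_scope.
Local Open Scope ring_scope.
Local Open Scope complex_scope.
Local Open Scope quotient_scope.

Section Subgroups.
Variable G : groupType.
Implicit Types (A D : set G) (x : G).

Definition is_subgroup A : Prop :=
  A 1%g /\ (forall x y, A x -> A y -> A (x / y)%g).

Record subgroup := Subgroup {
  subgroup_set :> set G;
  subgroupP : is_subgroup subgroup_set }.

Definition generated A : set G := smallest is_subgroup A.

Definition center A : set G :=
  [set x | A x /\ forall y, A y -> commute x y].

Definition commutator_subgroup A : set G :=
  generated [set [~ x, y]%g | x in A & y in A].

Definition left_coset x D : set G := [set (x * d)%g | d in D].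

(* The order of the quotient A / D; as always with [fset_set], this is 0 when
   the quotient is infinite. *)
Definition quotient_order A D : nat :=
  #|` fset_set [set left_coset x D | x in A]|.

Definition conjugate_set A x : set G := [set (a ^ x)%g | a in A].

Definition torsion_free A : Prop :=
  forall x (n : nat), A x -> (0 < n)%N -> (x ^+ n)%g = 1%g -> x = 1%g.

End Subgroups.

(* The subspace topology on A is discrete. *)
Definition discrete_subset (T : topologicalType) (A : set T) : Prop :=
  A `<=` isolated A.

Definition heis (R : realType) : Type := (R[i] * R)%type.

Section Heisenberg.
Variable R : realType.
Implicit Types g h k : heis R.

(* R[i] carries no topology by itself; R[i]^o has the norm topology. *)
HB.instance Definition _ := Topological.copy (heis R) (R[i]^o * R^o)%type.

Definition heis_mul g h : heis R :=
  (g.1 + h.1, g.2 + h.2 + 2 * complex.Im (g.1 * (h.1)^*)).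

Definition heis_inv g : heis R := (- g.1, - g.2).

Definition heis_one : heis R := (0, 0).

Fact heis_mulA : associative heis_mul.
Proof.
case=> [[x y] t] [[x' y'] t'] [[x'' y''] t'']; rewrite /heis_mul /=.
by congr (_, _); [rewrite addrA | ring].
Qed.

Fact heis_mul1g : left_id heis_one heis_mul.
Proof.
case=> [[x y] t]; rewrite /heis_mul /=.
by congr (_, _); [rewrite add0r | ring].
Qed.

Fact heis_mulg1 : right_id heis_one heis_mul.
Proof.
case=> [[x y] t]; rewrite /heis_mul /=.
by congr (_, _); [rewrite addr0 | ring].
Qed.

Fact heis_mulVg : left_inverse heis_one heis_inv heis_mul.
Proof.
case=> [[x y] t]; rewrite /heis_mul /heis_one /=.
by congr (_, _); [rewrite addNr | ring].
Qed.

Fact heis_mulgV : right_inverse heis_one heis_inv heis_mul.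
Proof.
case=> [[x y] t]; rewrite /heis_mul /heis_one /=.
by congr (_, _); [rewrite addrN | ring].
Qed.

HB.instance Definition _ := isGroup.Build (heis R)
  heis_mulA heis_mul1g heis_mulg1 heis_mulVg heis_mulgV.

End Heisenberg.

Definition Cstar (R : realType) : Type := {z : R[i] | z != 0}.

Section Cstar.
Variable R : realType.
Implicit Types l m : Cstar R.

HB.instance Definition _ := SubChoice.copy (Cstar R) {z : R[i] | z != 0}.

HB.instance Definition _ :=
  Topological.copy (Cstar R) (initial_topology (val : Cstar R -> R[i]^o)).

Definition Cstar_one : Cstar R := exist _ 1 (oner_neq0 _).

Definition Cstar_mul l m : Cstar R :=
  exist _ (val l * val m) (mulf_neq0 (valP l) (valP m)).

Definition Cstar_inv l : Cstar R := exist _ (val l)^-1 (invr_neq0 (valP l)).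

Fact Cstar_mulA : associative Cstar_mul.
Proof. by move=> l m n; apply: val_inj; exact: mulrA. Qed.

Fact Cstar_mul1g : left_id Cstar_one Cstar_mul.
Proof. by move=> l; apply: val_inj; exact: mul1r. Qed.

Fact Cstar_mulg1 : right_id Cstar_one Cstar_mul.
Proof. by move=> l; apply: val_inj; exact: mulr1. Qed.

Fact Cstar_mulVg : left_inverse Cstar_one Cstar_inv Cstar_mul.
Proof. by move=> l; apply: val_inj; exact: mulVf (valP l). Qed.

Fact Cstar_mulgV : right_inverse Cstar_one Cstar_inv Cstar_mul.
Proof. by move=> l; apply: val_inj; exact: mulfV (valP l). Qed.

HB.instance Definition _ := isGroup.Build (Cstar R)
  Cstar_mulA Cstar_mul1g Cstar_mulg1 Cstar_mulVg Cstar_mulgV.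

Definition Cstar_neg1 : Cstar R :=
  exist _ (-1) (etrans (congr1 negb (oppr_eq0 1)) (oner_neq0 _)).

End Cstar.

Definition dilation (R : realType) (l : Cstar R) (g : heis R) : heis R :=
  (val l * g.1, ComplexField.Normc.normc (val l) ^+ 2 * g.2).

(* The semidirect product of the Heisenberg group and C^*. *)
Definition heis_sim (R : realType) : Type := (heis R * Cstar R)%type.

Section HeisSim.
Variable R : realType.
Implicit Types (a b : heis_sim R) (g h : heis R) (l m : Cstar R).

HB.instance Definition _ :=
  Topological.copy (heis_sim R) (heis R * Cstar R)%type.

Lemma dilationM l g h : dilation l (g * h)%g = (dilation l g * dilation l h)%g.
Proof.
case: l => [[a b] ?]; case: g h => [[x y] t] [[x' y'] t'].
rewrite /dilation /= sqr_sqrtr ?addr_ge0 ?sqr_ge0 //.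
by congr (_, _); [rewrite mulrDr | rewrite /=; ring].
Qed.

Lemma dilation_comp l m g : dilation l (dilation m g) = dilation (l * m)%g g.
Proof.
rewrite /dilation /=; congr (_, _); first by rewrite mulrA.
by rewrite ComplexField.Normc.normcM exprMn mulrA.
Qed.

Lemma dilation1 g : dilation 1%g g = g.
Proof.
rewrite /dilation /= mul1r expr0n addr0 expr1n sqrtr1 expr1n mul1r.
by case: g.
Qed.

Lemma dilationg1 l : dilation l 1%g = 1%g.
Proof. by rewrite /dilation /= !mulr0. Qed.

Definition heis_sim_act a h : heis R := (a.1 * dilation a.2 h)%g.

Definition heis_sim_mul a b : heis_sim R :=
  ((a.1 * dilation a.2 b.1)%g, (a.2 * b.2)%g).

Definition heis_sim_one : heis_sim R := (1%g, 1%g).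

Definition heis_sim_inv a : heis_sim R :=
  (dilation a.2^-1%g a.1^-1%g, a.2^-1%g).

Fact heis_sim_mulA : associative heis_sim_mul.
Proof.
move=> a b c; rewrite /heis_sim_mul /=; congr (_, _); last exact: mulgA.
by rewrite dilationM dilation_comp mulgA.
Qed.

Fact heis_sim_mul1g : left_id heis_sim_one heis_sim_mul.
Proof. by case=> g l; rewrite /heis_sim_mul /= dilation1 !mul1g. Qed.

Fact heis_sim_mulg1 : right_id heis_sim_one heis_sim_mul.
Proof.
by case=> g l; rewrite /heis_sim_mul /= dilationg1 !mulg1.
Qed.

Fact heis_sim_mulVg : left_inverse heis_sim_one heis_sim_inv heis_sim_mul.
Proof.
case=> g l; rewrite /heis_sim_mul /heis_sim_one /= -dilationM !mulVg.
by rewrite dilationg1.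
Qed.

Fact heis_sim_mulgV : right_inverse heis_sim_one heis_sim_inv heis_sim_mul.
Proof.
case=> g l; rewrite /heis_sim_mul /heis_sim_one /= dilation_comp mulgV.
by rewrite dilation1 !mulgV.
Qed.

HB.instance Definition _ := isGroup.Build (heis_sim R)
  heis_sim_mulA heis_sim_mul1g heis_sim_mulg1 heis_sim_mulVg heis_sim_mulgV.

Lemma heis_sim_act1 h : heis_sim_act 1%g h = h.
Proof. by rewrite /heis_sim_act /= dilation1 mul1g. Qed.

Lemma heis_sim_actM a b h :
  heis_sim_act (a * b)%g h = heis_sim_act a (heis_sim_act b h).
Proof. by rewrite /heis_sim_act /= dilationM dilation_comp mulgA. Qed.

Definition pr2 a : Cstar R := a.2.

Definition heis_incl g : heis_sim R := (g, 1%g).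

Definition heis_isom : set (heis_sim R) := [set a | `|val a.2| = 1].

Section OrbitSpace.
Variable Gam : subgroup (heis_sim R).

Definition orbit_rel : rel (heis R) :=
  fun h k => `[< exists2 a, subgroup_set Gam a & k = heis_sim_act a h >].

Fact orbit_rel_refl : reflexive orbit_rel.
Proof.
move=> h; apply/asboolP; exists 1%g; last by rewrite heis_sim_act1.
by case: (subgroupP Gam).
Qed.

Fact orbit_rel_sym : symmetric orbit_rel.
Proof.
suff sub h k : orbit_rel h k -> orbit_rel k h by move=> h k; apply/idP/idP; exact: sub.
move=> /asboolP[a Gama ->]; apply/asboolP; exists a^-1%g.
  by have [Gam1 GamF] := subgroupP Gam; rewrite -[_^-1%g]mul1g; exact: GamF.
by rewrite -heis_sim_actM mulVg heis_sim_act1.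
Qed.

Fact orbit_rel_trans : transitive orbit_rel.
Proof.
move=> k h j /asboolP[a Gama ->] /asboolP[b Gamb ->]; apply/asboolP.
exists (b * a)%g; last by rewrite heis_sim_actM.
have [Gam1 GamF] := subgroupP Gam.
rewrite -[a]invgK; apply: (GamF) => //.
by rewrite -[_^-1%g]mul1g; exact: GamF.
Qed.

Definition orbit_equiv : equiv_rel (heis R) :=
  EquivRel orbit_rel orbit_rel_refl orbit_rel_sym orbit_rel_trans.

Definition orbit_space : Type := quotient_topology {eq_quot orbit_equiv}.

HB.instance Definition _ := Topological.on orbit_space.

End OrbitSpace.

Definition heis_bieberbach (Gam : subgroup (heis_sim R)) : Prop :=
  [/\ Gam `<=` heis_isom, discrete_subset Gam, torsion_free Gam
    & compact [set: orbit_space Gam]].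

Definition heis_lattice (tau : R[i]) (c : R) : set (heis_sim R) :=
  heis_incl @` generated ([set (1, 0); (tau, 0); (0, c)] : set (heis R)).

Definition heis_phi (c : R) : heis_sim R := ((0, c / 2), Cstar_neg1 R).

Definition Gamma_tau_c (tau : R[i]) (c : R) : set (heis_sim R) :=
  generated (heis_lattice tau c `|` [set heis_phi c]).

End HeisSim.

(* Main.v *)
From mathcomp Require Import ring lra normedtype.
Require Import Defs.
From mathcomp Require Import all_boot all_order all_algebra.
From mathcomp Require Import complex.
From mathcomp Require Import all_classical all_reals topology.
Import Order.TTheory GRing.Theory Num.Theory.
Local Open Scope classical_set_scope.
Local Open Scope ring_scope.
Local Open Scope complex_scope.

Set Implicit Arguments.
Unset Strict Implicit.
Unset Printing Implicit Defensive.

(** Why the theorem holds. Everything rests on reading heights. Put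
[area z w = Im (z conj w)], the form that twists the product of the group, let
[T] be the set of heights [t] of the vertical translations [(0, t)] in [Gam],
and let [L] be the set of first coordinates of the translations in [Gam].

- [T] is a discrete subgroup of the line. It is not zero, because the square
  of an element [((w, s), -1)] is the translation of height [2 s], which is
  nontrivial as [Gam] is torsion free. So [T = c Z] with [c > 0]
  ([vertical_cyclic]).
- Every element [((z, t), -1)] of [Gam] has [t] in [c/2 + c Z]: its square says
  that [2 t] is in [c Z], and if [t] itself were in [c Z], a vertical
  translation would correct it to [((z, 0), -1)], an involution ([rot_height]).
- Fix one such element over [w]. Multiplying a translation [(z, t)] by it gives
  again an element over [-1], and comparing heights shows that
  [t - 2 area w z] is in [c Z]. Thus [Gam] is determined by [L], [w] and [c],
  and closure under products forces [2 area z z'] into [c Z] on [L].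
- [L] does not lie in a real line: otherwise the distance to a suitable line
  would be a continuous unbounded function on the compact orbit space
  ([translations_span]).
- Since [area] takes its values on [L] in [(c/2) Z], a smallest positive value
  [n (c/2)] is attained, and elements [u], [v] of [L] with
  [area v u = n (c/2)] form a basis of [L] ([integral_area_basis]).

This is [bieberbach_normal_form]. The center of the translation subgroup is
[c Z] and its commutators have heights [4 area z z'], which fill
[4 area v u Z = 2 n c Z]; hence [N = 2 n], which is even and positive. Finally
the element [((w / 2, 0), u)] conjugates [Gam] to the normal form with
[w = 0], [u = 1], [v / u] in place of [v] and [c / |u|^2] in place of [c]
([conjugate_half_turn_group]), and that normal form is [Gamma_tau_c]
([Gamma_tau_cE]). *)

(** * The area form *)

Definition area {R : realType} (z w : R[i]) : R := complex.Im (z * w^*).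

Section Area.
Variable R : realType.
Implicit Types (z w : R[i]) (r : R).

Lemma areaE z w :
  area z w = complex.Im z * complex.Re w - complex.Re z * complex.Im w.
Proof. by case: z w => [a b] [a' b']; rewrite /area /=; ring. Qed.

Lemma areaC z w : area w z = - area z w.
Proof. by rewrite !areaE; ring. Qed.

Lemma areazz z : area z z = 0.
Proof. by rewrite areaE; ring. Qed.

Lemma areaDl z z' w : area (z + z') w = area z w + area z' w.
Proof. by rewrite !areaE !raddfD /=; ring. Qed.

Lemma areaDr z w w' : area z (w + w') = area z w + area z w'.
Proof. by rewrite areaC areaDl opprD -!areaC. Qed.

Lemma areaNl z w : area (- z) w = - area z w.
Proof. by rewrite !areaE !raddfN /=; ring. Qed.

Lemma areaNr z w : area z (- w) = - area z w.
Proof. by rewrite areaC areaNl -areaC. Qed.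

Lemma area0l w : area 0 w = 0.
Proof. by rewrite areaE /=; ring. Qed.

Lemma area0r z : area z 0 = 0.
Proof. by rewrite areaC area0l oppr0. Qed.

Lemma areaMzl z w (m : int) : area (z *~ m) w = m%:~R * area z w.
Proof.
have zn n : area (z *+ n) w = n%:R * area z w.
  elim: n => [|n IHn]; first by rewrite area0l mul0r.
  by rewrite mulrS areaDl IHn mulrSr mulrDl mul1r addrC.
case: m => n; first exact: zn.
by rewrite NegzE !mulrNz areaNl mulNr; congr (- _); exact: zn.
Qed.

Lemma areaMzr z w (m : int) : area z (w *~ m) = m%:~R * area z w.
Proof. by rewrite areaC areaMzl areaC mulrN opprK. Qed.

Lemma area_realMl (z w : R[i]) r : area (r%:C * z) w = r * area z w.
Proof. by case: z => a b; rewrite !areaE /=; ring. Qed.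

(** Cramer's rule in the real plane, written with complex numbers. *)
Lemma area_basis_expansion z u v :
  (area u v)%:C * z = (area z v)%:C * u + (area u z)%:C * v.
Proof.
case: z u v => [a b] [c d] [e f]; rewrite !areaE /=.
by apply/eqP; rewrite eq_complex /=; apply/andP; split; apply/eqP; ring.
Qed.

Lemma area_nondegenerate z u v :
  area u v != 0 -> area z u = 0 -> area z v = 0 -> z = 0.
Proof.
move=> uv zu zv; have := area_basis_expansion z u v.
rewrite zv (areaC z u) zu oppr0 !mul0r addr0 => /eqP; rewrite mulf_eq0.
by rewrite (inj_eq (@complexI R)) (negPf uv) => /eqP.
Qed.

Lemma area_mulr u z :
  area (u * z) u = ComplexField.Normc.normc u ^+ 2 * complex.Im z.
Proof.
case: u z => [a b] [x y]; rewrite areaE /= sqr_sqrtr ?addr_ge0 ?sqr_ge0 //.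
by ring.
Qed.

End Area.

(** * Discrete subgroups of the line and lattices of the plane *)

(** The generator is the infimum of the positive elements, which the gap keeps
away from [0]. *)
Lemma gapped_subgroup_cyclic (R : realType) (T : set R) (e s : R) :
  T 0 -> (forall x y, T x -> T y -> T (x - y)) ->
  0 < e -> (forall t, `|t| < e -> T t -> t = 0) ->
  T s -> s != 0 ->
  exists2 c : R, 0 < c & forall t, T t <-> exists m : int, t = m%:~R * c.
Proof.
move=> T0 TB e0 gap Ts s0.
have TN x : T x -> T (- x) by move=> Tx; rewrite -sub0r; apply: TB.
have TMn x n : T x -> T (x *+ n).
  move=> Tx; elim: n => [|n IHn]; first by rewrite mulr0n.
  by rewrite mulrS -[x in x + _]opprK addrC; apply: TB => //; apply: TN.
have TMz x (m : int) : T x -> T (m%:~R * x).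
  move=> Tx; rewrite mulrzl; case: m => n; first exact: TMn.
  by rewrite NegzE mulrNz; apply: TN; apply: TMn.
pose P := [set t | T t /\ 0 < t].
have P0 : P !=set0.
  by exists `|s|; split; rewrite ?normr_gt0 //; case: ger0P => // _; apply: TN.
have hP : has_inf P by split => //; exists 0 => t [_ /ltW].
have Pinf t : P t -> inf P <= t by move=> Pt; apply: ge_inf => //; case: hP.
have Te t : T t -> 0 < t -> e <= t.
  move=> Tt t0; rewrite leNgt; apply/negP => te; move: (t0).
  by rewrite (gap t) ?ltxx // gtr0_norm.
(* Elements of P close to inf P would differ by less than the gap. *)
have PI : P (inf P).
  have [t Pt te] := inf_adherent e0 hP.
  suff -> : inf P = t by [].
  apply/eqP; rewrite eq_le Pinf //=; apply: lb_le_inf => // u Pu.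
  rewrite leNgt; apply/negP => ut.
  have Ttu : T (t - u) by apply: TB; [case: Pt | case: Pu].
  have := Te _ Ttu; rewrite subr_gt0 ut => /(_ isT).
  by have := Pinf u Pu; lra.
case: (PI) => TI I0; exists (inf P) => // t; split; last by case=> m ->; apply: TMz.
move=> Tt; exists (Num.floor (t / inf P)); apply/eqP; rewrite -subr_eq0.
have Tr : T (t - (Num.floor (t / inf P))%:~R * inf P) by apply: TB => //; apply: TMz.
have /andP[r0 r1] := floor_itv (t / inf P).
rewrite eq_le; apply/andP; split; last first.
  by rewrite subr_ge0 -ler_pdivlMr.
rewrite leNgt; apply/negP => rpos.
have := Pinf _ (conj Tr rpos); rewrite leNgt => /negP; apply.
by move: r1; rewrite ltr_pdivrMr // intrD mulrDl mul1r ltrBlDl.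
Qed.

(** Take [u], [v] in [L] with the least positive multiple of [d] as area. An
element [z] of [L] has coordinates [area v z / area v u] along [u] and
[area z u / area v u] along [v]. They are integers: subtracting from [z] a
multiple of [u] or [v] changes these areas by multiples of [area v u], and a
remainder would be a smaller positive value. *)
Lemma integral_area_basis (R : realType) (L : set R[i]) (d : R) :
  0 < d -> (forall z w, L z -> L w -> L (z - w)) ->
  (forall z w, L z -> L w -> exists m : int, area z w = m%:~R * d) ->
  (exists z w, [/\ L z, L w & area z w != 0]) ->
  exists u v (n : nat), [/\ (0 < n)%N, area v u = n%:R * d &
    forall z, L z <-> exists m k : int, z = u *~ m + v *~ k].
Proof.
move=> d0 LB Ld [z0 [w0 [Lz0 Lw0 zw0]]].
have L0 : L 0 by rewrite -(subrr z0); apply: LB.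
have LN z : L z -> L (- z) by move=> Lz; rewrite -sub0r; apply: LB.
have LD z w : L z -> L w -> L (z + w).
  by move=> Lz Lw; rewrite -[w]opprK; apply: LB => //; apply: LN.
have LMz z (m : int) : L z -> L (z *~ m).
  move=> Lz; have LMn n : L (z *+ n).
    by elim: n => [|n IHn]; rewrite ?mulr0n // mulrS; apply: LD.
  by case: m => n; rewrite ?NegzE ?mulrNz; [|apply: LN]; apply: LMn.
pose good n := (0 < n)%N && `[< exists u v, [/\ L u, L v & area v u = n%:R * d] >].
have exg : exists n, good n.
  have [[n|n] zwE] := Ld _ _ Lz0 Lw0.
  - exists n; apply/andP; split.
      by rewrite lt0n; apply: contra_neq zw0 => n0; rewrite zwE n0 mul0r.
    by apply/asboolP; exists w0, z0.
  - exists n.+1; apply/andP; split => //; apply/asboolP; exists z0, w0; split => //.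
    by rewrite areaC zwE NegzE mulrNz mulNr opprK.
have [n /andP[n0 /asboolP[u [v [Lu Lv vuE]]]] nmin] := ex_minnP exg.
exists u, v, n; split => // z; split; last first.
  by move=> [m [k ->]]; apply: LD; apply: LMz.
have nd0 : n%:R * d != 0 by rewrite mulf_neq0 ?gt_eqF ?ltr0n.
(* A value that can be reduced modulo n d is a multiple of it, as n is least. *)
have mult x y : L x -> L y -> (forall k : int, exists x' y',
    [/\ L x', L y' & area x' y' = area x y - k%:~R * (n%:R * d)]) ->
    exists k : int, area x y = k%:~R * (n%:R * d).
  move=> Lx Ly red; have [m mE] := Ld x y Lx Ly.
  have nz : n%:Z != 0 by rewrite eqz_nat -lt0n.
  exists (m %/ n%:Z)%Z; have [x' [y' [Lx' Ly']]] := red (m %/ n%:Z)%Z.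
  have [r rE] : exists r : nat, (m %% n%:Z)%Z = r%:Z.
    by exists `|(m %% n%:Z)%Z|%N; rewrite gez0_abs // modz_ge0.
  have rn : (r < n)%N by rewrite -ltz_nat -rE ltz_pmod.
  have mnE : area x y = (m %/ n%:Z)%Z%:~R * (n%:R * d) + r%:R * d.
    by rewrite mE {1}(divz_eq m n) rE intrD intrM; ring.
  rewrite mnE addrC addKr => xyE; case: r rn xyE {rE mnE} => [|r] rn xyE.
    by rewrite mul0r addr0.
  suff : (n <= r.+1)%N by rewrite leqNgt rn.
  by apply: nmin; apply/andP; split => //; apply/asboolP; exists y', x'.
move=> Lz.
have [m mE] : exists k : int, area v z = k%:~R * (n%:R * d).
  apply: mult => // k; exists v, (z - u *~ k); split => //.
    by apply: LB => //; apply: LMz.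
  by rewrite areaDr areaNr areaMzr vuE.
have [k kE] : exists k : int, area z u = k%:~R * (n%:R * d).
  apply: mult => // k; exists (z - v *~ k), u; split => //.
    by apply: LB => //; apply: LMz.
  by rewrite areaDl areaNl areaMzl vuE.
exists m, k; apply: (@mulfI _ (n%:R * d)%:C).
  by rewrite (inj_eq (@complexI R)).
rewrite -{1}vuE area_basis_expansion mE kE.
have CM (x : int) (y : R) : (x%:~R * y)%:C = x%:~R * y%:C.
  by rewrite (rmorphM (real_complex R)) /= (rmorph_int (real_complex R)).
rewrite (CM k) (CM m) -(mulrzl u m) -(mulrzl v k); ring.
Qed.

(** * Subgroups of an abstract group *)

Section GeneratedSubgroups.
Variable G : groupType.
Implicit Types (A S : set G) (x y : G).

Lemma generated_subgroup A : is_subgroup (generated A).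
Proof.
split=> [S [[S1 _] _] //|x y Ax Ay S [sS AS]].
by have [_ SB] := sS; apply: SB; [apply: Ax | apply: Ay].
Qed.

Lemma sub_generated A : A `<=` generated A.
Proof. exact: sub_gen_smallest. Qed.

Lemma generated_sub A S : is_subgroup S -> A `<=` S -> generated A `<=` S.
Proof. exact: smallest_sub. Qed.

Lemma subgroupV S x : is_subgroup S -> S x -> S x^-1%g.
Proof. by move=> [S1 SB] Sx; rewrite -[_^-1%g]mul1g; apply: SB. Qed.

Lemma subgroupM S x y : is_subgroup S -> S x -> S y -> S (x * y)%g.
Proof.
by move=> sS Sx Sy; rewrite -[y]invgK; apply: sS.2 => //; apply: subgroupV.
Qed.

Lemma subgroup_int S (f : int -> G) (m : int) :
  is_subgroup S -> (forall k l, f (k + l) = (f k * f l)%g) -> S (f 1) -> S (f m).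
Proof.
move=> sS fD S1.
have f0 : f 0 = 1%g by apply: (@mulgI _ (f 0)); rewrite -fD addr0 mulg1.
have Sn (n : nat) : S (f n).
  elim: n => [|n IHn]; first by rewrite f0; case: sS.
  by rewrite intS fD; apply: subgroupM.
case: m => n //; rewrite NegzE.
have -> : f (- n.+1%:Z) = (f n.+1%:Z)^-1%g.
  by apply: (@mulIg _ (f n.+1%:Z)); rewrite -fD addNr f0 mulVg.
exact: subgroupV.
Qed.
End GeneratedSubgroups.

Lemma quotient_order_cyclic (G : groupType) (f : int -> G) (N : nat) :
  (forall m k, f (m + k) = (f m * f k)%g) -> injective f -> (0 < N)%N ->
  quotient_order (range f) [set f (m * N%:Z) | m in setT] = N.
Proof.
move=> fD finj N0; apply: card_fset_set.
set D := [set f (m * N%:Z) | m in setT].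
suff -> : [set left_coset x D | x in range f] =
    [set left_coset (f i%:Z) D | i in `I_N].
  apply: inj_card_eq => i j; rewrite !inE /= => iN jN eqD.
  have : left_coset (f j%:Z) D (f i%:Z).
    rewrite -eqD; exists (f 0); first by exists 0.
    by rewrite -fD addr0.
  move=> [_ [k _ <-]]; rewrite -fD => /finj.
  move=> /(congr1 (fun x => (x %% N%:Z)%Z)).
  by rewrite addrC modzMDl !modz_small // => -[].
have shift m k : left_coset (f (m + k * N%:Z)) D = left_coset (f m) D.
  apply/seteqP; split => _ [_ [l _ <-] <-].
    exists (f ((k + l) * N%:Z)); first by exists (k + l).
    by rewrite -!fD mulrDl addrA.
  exists (f ((l - k) * N%:Z)); first by exists (l - k).
  by rewrite -!fD -addrA -mulrDl subrKC.
apply/seteqP; split => [_ [_ [m _ <-] <-]|_ [i _ <-]]; last by exists (f i%:Z).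
have Nz : N%:Z != 0 by rewrite eqz_nat -lt0n.
exists `|(m %% N%:Z)%Z|%N.
  by rewrite /= -ltz_nat gez0_abs ?modz_ge0 // ltz_pmod.
by rewrite gez0_abs ?modz_ge0 // [in RHS](divz_eq m N%:Z) addrC shift.
Qed.

(** * Topology of the group and of its orbit spaces *)

Lemma discrete_vertical_gap (R : realType) (Gam : set (heis_sim R)) :
  discrete_subset Gam -> Gam 1%g ->
  exists2 e : R, 0 < e &
    forall t, `|t| < e -> Gam (heis_incl (0, t)) -> t = 0.
Proof.
move=> dG G1; have [_ [V V1 VG]] := dG _ G1.
pose f (t : R^o) : heis_sim R := heis_incl (0, t).
have cf : {for (0 : R^o), continuous f}.
  have cg : (((0 : R[i]^o), t) : heis R) @[t --> (0 : R^o)] --> (1%g : heis R).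
    apply: (@cvg_pair _ _ _ _ (nbhs (0 : R[i]^o)) (nbhs (0 : R^o))).
      exact: cvg_cst.
    exact: cvg_id.
  apply: (@cvg_pair _ _ _ _ (nbhs (1%g : heis R)) (nbhs (1%g : Cstar R))) => //.
  exact: cvg_cst.
have : nbhs (0 : R^o) (f @^-1` V) by apply: cf.
move=> /nbhs_ballP[e /= e0 eV]; exists e => // t te Gt.
suff : [set (1%g : heis_sim R)] (f t) by case.
rewrite -VG; split => //; apply: eV.
by rewrite /ball /= sub0r normrN.
Qed.

(** An invariant function factors through the orbit space, where compactness
bounds it. *)
Lemma invariant_bounded (R : realType) (Gam : subgroup (heis_sim R))
    (f : heis R -> R^o) :
  compact [set: orbit_space Gam] -> continuous f ->
  (forall a h, subgroup_set Gam a -> f (heis_sim_act a h) = f h) ->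
  exists M : R, forall h, `|f h| <= M.
Proof.
move=> cG cf fG.
have crf : continuous (f \o repr : orbit_space Gam -> R^o).
  apply: repr_comp_continuous => // h k.
  move=> /eqP/(@eqmodP _ (orbit_equiv Gam))/asboolP[a Ga ->].
  by rewrite fG.
have /compact_bounded[M [_ Mf]] := continuous_compact (continuous_subspaceT crf) cG.
exists (M + 1) => h.
have := Mf (M + 1); rewrite ltrDl => /(_ ltr01) /= Mh.
have [a Ga ha] : exists2 a, subgroup_set Gam a &
    repr (\pi_(orbit_space Gam) h)%qT = heis_sim_act a h.
  apply/asboolP; rewrite -[X in is_true X]/(orbit_equiv Gam h _).
  apply/(@eqmodP _ (orbit_equiv Gam)).
  by rewrite [RHS](@reprK _ {eq_quot orbit_equiv Gam}%qT).
by rewrite -(fG a h Ga) -ha; apply: Mh; exists (\pi_(orbit_space Gam) h)%qT.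
Qed.

Lemma continuous_area (R : realType) (u v : R[i]) :
  continuous (fun h : heis R => area (h.1 - v) u : R^o).
Proof.
have cIm : continuous (@complex.Im R : R[i]^o -> R^o).
  move=> z W /nbhs_ballP[e /= e0 eW].
  apply/nbhs_ballP; exists e%:C; first by rewrite /= ltcR.
  move=> w zw; apply: eW; move: zw; rewrite /ball /= normc_def ltcR => zw.
  apply: le_lt_trans zw; rewrite -sqrtr_sqr ler_wsqrtr //.
  by rewrite -raddfB lerDr sqr_ge0.
have cL : continuous (fun h : heis R => (h.1 - v) * u^* : R[i]^o).
  move=> h; apply: (@cvgMr_tmp (R[i]) (heis R) (nbhs h) _ (fun h => h.1 - v)).
  apply: (@cvgB (R[i]) (R[i]^o) (heis R) (nbhs h)).
    exact: (@cvg_fst _ _ (nbhs (h.1 : R[i]^o)) (nbhs (h.2 : R^o))).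
  exact: cvg_cst.
move=> h; apply: (@continuous_comp _ (R[i]^o) (R^o)); last exact: cIm.
exact: cL.
Qed.

(** * Elements and the normal form *)

Section Elements.
Variable R : realType.
Implicit Types (g h : heis R) (z w : R[i]) (t s : R).

(** The half-turn [(z, t) |-> (- z, t)] followed by the left translation by
[g]. *)
Definition heis_rot g : heis_sim R := (g, Cstar_neg1 R).

Definition reflect_heis g : heis R := (- g.1, g.2).

Lemma heisM z t w s :
  (((z, t) : heis R) * ((w, s) : heis R))%g = (z + w, t + s + 2 * area z w).
Proof. by []. Qed.

Lemma heisV z t : (((z, t) : heis R)^-1)%g = (- z, - t).
Proof. by []. Qed.

Lemma dilation_neg1 g : dilation (Cstar_neg1 R) g = reflect_heis g.
Proof.
case: g => z t; rewrite /dilation /reflect_heis /= mulN1r.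
by rewrite oppr0 expr0n addr0 sqrrN expr1n sqrtr1 expr1n mul1r.
Qed.

Lemma heis_inclM g h : heis_incl (g * h)%g = (heis_incl g * heis_incl h)%g.
Proof. by congr (_, _); rewrite ?dilation1 ?mul1g. Qed.

Lemma heis_inclV g : heis_incl (g^-1)%g = ((heis_incl g)^-1)%g.
Proof.
by apply: (@mulIg _ (heis_incl g)); rewrite -heis_inclM !mulVg.
Qed.

Lemma heis_incl_rot g h : (heis_incl g * heis_rot h)%g = heis_rot (g * h)%g.
Proof. by congr (_, _); rewrite ?dilation1 ?mul1g. Qed.

Lemma heis_rot_incl g h :
  (heis_rot g * heis_incl h)%g = heis_rot (g * reflect_heis h)%g.
Proof. by congr (_, _); rewrite ?mulg1 // dilation_neg1. Qed.

Lemma heis_rot_rot g h :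
  (heis_rot g * heis_rot h)%g = heis_incl (g * reflect_heis h)%g.
Proof.
congr (_, _); first by rewrite dilation_neg1.
by apply: val_inj; rewrite /= mulrNN mulr1.
Qed.

Lemma heis_rotV g : ((heis_rot g)^-1)%g = heis_rot (reflect_heis g^-1)%g.
Proof.
apply: (@mulgI _ (heis_rot g)); rewrite mulgV heis_rot_rot.
case: g => z t; rewrite heisV /reflect_heis /= opprK heisM.
by rewrite !subrr areaNr areazz oppr0 mulr0 addr0.
Qed.

Lemma heis_rot_neq1 g : heis_rot g <> 1%g.
Proof.
move=> /(congr1 (fun a : heis_sim R => complex.Re (val a.2))) /= N1.
by have := @ltr01 R; lra.
Qed.

Lemma heis_rot_sqr z t :
  (heis_rot (z, t) * heis_rot (z, t))%g = heis_incl (0, 2 * t).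
Proof.
rewrite heis_rot_rot /reflect_heis /= heisM subrr areaNr areazz.
by rewrite oppr0 mulr0 addr0 mulr2n mulrDl mul1r.
Qed.

Lemma heis_commg g h :
  [~ heis_incl g, heis_incl h]%g = heis_incl (0, 4 * area g.1 h.1).
Proof.
apply: (@mulgI _ (heis_incl h * heis_incl g)%g); rewrite -commgC -!heis_inclM.
case: g h => [z t] [w s]; rewrite !heisM area0r addr0 /= (areaC z w) addrC.
by congr (heis_incl (_, _)); ring.
Qed.

End Elements.

Section NormalForm.
Variable R : realType.
Implicit Types (z w u v : R[i]) (c : R).

Definition lattice_pt u v (m k : int) : R[i] := u *~ m + v *~ k.

Definition trans_elt w u v c (m k l : int) : heis R :=
  let z := lattice_pt u v m k in (z, 2 * area w z + l%:~R * c).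

Definition rot_elt w u v c (m k l : int) : heis R :=
  (w + lattice_pt u v m k, c / 2 + l%:~R * c).

(** Translations are indexed by their coordinates in the basis [u], [v] and by
their height relative to the twist [2 area w z], which measures that the
half-turns are centred over [w / 2] and not over the origin. *)
Definition half_turn_group w u v c : set (heis_sim R) :=
  [set a | exists m k l, a = heis_incl (trans_elt w u v c m k l) \/
                         a = heis_rot (rot_elt w u v c m k l)].

End NormalForm.

(** * Bieberbach groups are in normal form *)

Section Structure.
Variables (R : realType) (Gam : subgroup (heis_sim R)).
Hypothesis Gb : heis_bieberbach Gam.
Hypothesis G2 : @pr2 R @` Gam = generated [set Cstar_neg1 R].
Notation inG := (subgroup_set Gam).
Let sG : is_subgroup inG := subgroupP Gam.

Lemma incl_or_rot a : inG a -> exists g, a = heis_incl g \/ a = heis_rot g.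
Proof.
case: a => g l Ga; exists g.
have : generated [set Cstar_neg1 R] l by rewrite -G2; exists (g, l).
pose S : set (Cstar R) := [set 1%g; Cstar_neg1 R].
have NN : (Cstar_neg1 R * Cstar_neg1 R)%g = 1%g.
  by apply: val_inj; rewrite /= mulrNN mulr1.
have NV : (Cstar_neg1 R)^-1%g = Cstar_neg1 R.
  by apply: (@mulgI _ (Cstar_neg1 R)); rewrite NN mulgV.
have sS : is_subgroup S.
  split; first by left.
  move=> _ _ [->|->] [->|->]; rewrite ?invg1 ?mulg1 ?mul1g ?NV ?NN.
  - by left.
  - by right.
  - by right.
  - by left.
have genS : generated [set Cstar_neg1 R] `<=` S.
  apply: generated_sub sS _ => x ->. by right.
by move=> /genS[->|->]; [left | right].
Qed.

Lemma exists_rot : exists w s, inG (heis_rot (w, s)).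
Proof.
have : (@pr2 R @` Gam) (Cstar_neg1 R) by rewrite G2; apply: sub_generated.
by move=> [[[w s] l] Ga lE]; exists w, s; rewrite /heis_rot -lE.
Qed.

(** The square of a half-turn is a vertical translation, so there is a
nontrivial one. *)
Lemma vertical_cyclic : exists2 c : R, 0 < c &
  forall t, inG (heis_incl (0, t)) <-> exists m : int, t = m%:~R * c.
Proof.
have [_ dG tG _] := Gb; have [w [s Gws]] := exists_rot.
have [e e0 gap] := discrete_vertical_gap dG sG.1.
have G2s : inG (heis_incl (0, 2 * s)).
  by rewrite -(heis_rot_sqr w); apply: subgroupM.
apply: (gapped_subgroup_cyclic (T := [set t | inG (heis_incl (0, t))]) _ _ e0 gap G2s).
- exact: sG.1.
- move=> x y /= Gx Gy; have := sG.2 _ _ Gx Gy.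
  by rewrite -heis_inclV -heis_inclM heisV heisM subrr area0l mulr0 addr0.
- apply/eqP => s0; apply: (@heis_rot_neq1 R (w, s)); apply: (tG _ 2%N) => //.
  by rewrite expgS expg1 heis_rot_sqr s0.
Qed.

(** Torsion-freeness enters here: a half-turn whose height is in [c Z] would be,
up to a vertical translation of the group, an involution. *)
Lemma rot_height c : 0 < c ->
  (forall t, inG (heis_incl (0, t)) <-> exists m : int, t = m%:~R * c) ->
  forall z t, inG (heis_rot (z, t)) -> exists m : int, t = c / 2 + m%:~R * c.
Proof.
move=> c0 Tc z t Gzt; have [_ _ tG _] := Gb.
have /Tc[m mE] : inG (heis_incl (0, 2 * t)).
  by rewrite -(heis_rot_sqr z); apply: subgroupM.
have [k [b mkE]] : exists k : int, exists b : bool, m = k * 2 + b%:Z.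
  exists (m %/ 2)%Z, ((m %% 2)%Z == 1); rewrite {1}(divz_eq m 2); congr (_ + _).
  have := ltz_pmod m (isT : 0 < 2 :> int); have := @modz_ge0 m 2 isT.
  by case: (m %% 2)%Z => [[|[|]]|].
have {mE} tE : t = k%:~R * c + b%:R * (c / 2).
  apply: (@mulfI _ 2); first by rewrite pnatr_eq0.
  by rewrite mE mkE intrD intrM; case: (b) => /=; field.
case: b tE {mkE} => tE; first by exists k; rewrite tE mul1r addrC.
have Gz0 : inG (heis_rot (z, 0)).
  have Gt : inG (heis_incl (0, - t)).
    by apply/Tc; exists (- k); rewrite tE /= mulr0n mul0r addr0 mulrNz mulNr.
  have := subgroupM sG Gzt Gt; rewrite heis_rot_incl /reflect_heis /= heisM.
  by rewrite oppr0 addr0 area0r subrr mulr0 addr0.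
case: (@heis_rot_neq1 R (z, 0)); apply: (tG _ 2%N) => //.
by rewrite expgS expg1 heis_rot_sqr mulr0.
Qed.

(** If the translations project into a real line [R u], the distance from the
line through the centre [w / 2] parallel to [u] is invariant and unbounded. *)
Lemma translations_span (L : set R[i]) w s :
  (forall z t, inG (heis_incl (z, t)) -> L z) ->
  inG (heis_rot (w, s)) ->
  exists z z', [/\ L z, L z' & area z z' != 0].
Proof.
move=> LG Gws; have [_ _ _ cG] := Gb; apply: contrapT => Ldeg.
have L0 z z' : L z -> L z' -> area z z' = 0.
  by move=> Lz Lz'; apply/eqP/negPn/negP => zz'; apply: Ldeg; exists z, z'.
have [u [u0 Lu]] : exists u : R[i], u != 0 /\ forall z, L z -> area z u = 0.
  have [[u Lu u0]|Lz] := pselect (exists2 u, L u & u != 0).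
    by exists u; split => // z Lz; apply: L0.
  (* Here L = 0 and any direction will do. *)
  exists 1; split => [|z Lzz]; first exact: oner_neq0.
  have -> : z = 0 by apply/eqP/negPn/negP => z0; apply: Lz; exists z.
  exact: area0l.
pose f (h : heis R) : R^o := `|area (h.1 - w / 2) u|.
have cf : continuous f.
  move=> h; apply: (@continuous_comp _ R^o R^o); first exact: continuous_area.
  exact: norm_continuous.
have fG a h : inG a -> f (heis_sim_act a h) = f h.
  move=> Ga; have [[z t] [aE|aE]] := incl_or_rot Ga; rewrite aE in Ga *.
    rewrite /f /heis_sim_act dilation1 /=.
    have -> : z + h.1 - w / 2 = z + (h.1 - w / 2) by rewrite addrA.
    rewrite areaDl.
    by rewrite (Lu z) ?add0r //; apply: LG Ga.
  have Lzw : L (z - w).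
    have := sG.2 _ _ Ga Gws; rewrite heis_rotV heis_rot_rot.
    by rewrite heisV /reflect_heis /= opprK heisM; apply: LG.
  rewrite /f /heis_sim_act dilation_neg1 /=.
  have -> : z - h.1 - w / 2 = (z - w) - (h.1 - w / 2) by field.
  by rewrite areaDl areaNl Lu // add0r normrN.
have [M fM] := invariant_bounded cG cf fG.
(* Moving in the direction 'i u, orthogonal to u, makes f unbounded. *)
pose D := area ('i * u) u.
have D0 : D != 0.
  move: u0; rewrite {}/D {Lu f cf fG fM}; case: u => a b; rewrite eq_complex /= => ab.
  rewrite areaE /=; apply: contra ab => /eqP E; apply/andP; split; apply/eqP; nra.
have := fM (w / 2 + ((`|M| + 1) / D)%:C * ('i * u), 0).
rewrite /f /= addrAC subrr add0r area_realMl -/D divfK //.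
rewrite normr_id ger0_norm ?addr_ge0 // => M1.
by have := le_trans M1 (ler_norm M); rewrite gerDl ler10.
Qed.

(** Composing translations with one half-turn reduces all heights to those of
half-turns, known from [rot_height]. *)
Lemma bieberbach_normal_form : exists w u v c (n : nat),
  [/\ 0 < c, (0 < n)%N, area v u = n%:R * (c / 2) & inG = half_turn_group w u v c].
Proof.
have [c c0 Tc] := vertical_cyclic; have [w [s Gws]] := exists_rot.
have rotE := rot_height c0 Tc.
pose L : set R[i] := [set z | exists t, inG (heis_incl (z, t))].
have inclE z t : inG (heis_incl (z, t)) -> exists l : int, t = 2 * area w z + l%:~R * c.
  move=> Gzt; have [l sE] := rotE _ _ Gws.
  have := subgroupM sG Gzt Gws; rewrite heis_incl_rot heisM => /rotE[m mE].
  exists (m - l); apply: (addIr (s + 2 * area z w)); rewrite addrA mE sE.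
  by rewrite (areaC w z) intrB; ring.
have LB z z' : L z -> L z' -> L (z - z').
  move=> [t Gz] [t' Gz']; have := sG.2 _ _ Gz Gz'.
  by rewrite -heis_inclV -heis_inclM heisV heisM => Gzz; eexists; exact: Gzz.
have Lc z z' : L z -> L z' -> exists m : int, area z z' = m%:~R * (c / 2).
  move=> [t Gz] [t' Gz']; have [l lE] := inclE _ _ Gz; have [l' lE'] := inclE _ _ Gz'.
  have := subgroupM sG Gz Gz'; rewrite -heis_inclM heisM => /inclE[m mE].
  exists (m - l - l'); apply: (@mulfI _ 2); first by rewrite pnatr_eq0.
  have -> : 2 * area z z' = m%:~R * c - l%:~R * c - l'%:~R * c.
    by move: mE; rewrite lE lE' areaDr; lra.
  by rewrite !intrB; field.
have Lspan : exists z z', [/\ L z, L z' & area z z' != 0].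
  by apply: translations_span Gws => z t Gzt; exists t.
have c20 : 0 < c / 2 by rewrite divr_gt0.
have [u [v [n [n0 vuE LE]]]] := integral_area_basis c20 LB Lc Lspan.
have shift z t (l : int) :
    inG (heis_incl (z, t)) -> inG (heis_incl (z, t + l%:~R * c)).
  move=> Gz; have Gl : inG (heis_incl (0, l%:~R * c)) by apply/Tc; exists l.
  have := subgroupM sG Gl Gz; rewrite -heis_inclM heisM area0l mulr0 addr0 add0r.
  by rewrite addrC.
have rshift z t (l : int) :
    inG (heis_rot (z, t)) -> inG (heis_rot (z, t + l%:~R * c)).
  move=> Gz; have Gl : inG (heis_incl (0, l%:~R * c)) by apply/Tc; exists l.
  have := subgroupM sG Gl Gz; rewrite heis_incl_rot heisM area0l mulr0 addr0 add0r.
  by rewrite addrC.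
exists w, u, v, c, n; split => //; apply/seteqP; split => a.
  move=> Ga; have [[z t] [aE|aE]] := incl_or_rot Ga; rewrite {a}aE in Ga *.
    have /LE[m [k zE]] : L z by exists t.
    have [l ->] := inclE _ _ Ga; exists m, k, l; left.
    by rewrite /trans_elt /lattice_pt -zE.
  have /LE[m [k zE]] : L (z - w).
    have := sG.2 _ _ Ga Gws; rewrite heis_rotV heis_rot_rot.
    by rewrite heisV /reflect_heis /= opprK heisM => Gzw; eexists; exact: Gzw.
  have [l ->] := rotE _ _ Ga; exists m, k, l; right.
  by rewrite /rot_elt /lattice_pt -zE subrKC.
move=> [m [k [l]]]; rewrite /trans_elt /rot_elt.
have : L (lattice_pt u v m k) by apply/LE; exists m, k.
move: (lattice_pt u v m k) => z [t Gz] [] ->.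
  have [l' tE] := inclE _ _ Gz.
  have := shift _ _ (l - l') Gz; rewrite tE intrB.
  by congr (inG (heis_incl (_, _))); ring.
have := subgroupM sG Gz Gws; rewrite heis_incl_rot heisM addrC => Gzw.
have [l' tE] := rotE _ _ Gzw.
have := rshift _ _ (l - l') Gzw; rewrite tE intrB.
by congr (inG (heis_rot (_, _))); ring.
Qed.

End Structure.

(** * Invariants and conjugation of the normal form *)

Section NormalFormFacts.
Variable R : realType.
Implicit Types (z w u v : R[i]) (c : R).

Lemma lattice_ptB u v m k m' k' :
  lattice_pt u v m k - lattice_pt u v m' k' = lattice_pt u v (m - m') (k - k').
Proof. by rewrite /lattice_pt !mulrzBr; ring. Qed.

Lemma area_lattice_pt u v m k m' k' :
  area (lattice_pt u v m k) (lattice_pt u v m' k') =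
  (k * m' - m * k')%:~R * area v u.
Proof.
rewrite /lattice_pt !areaDl !areaDr !areaMzl !areaMzr !areazz (areaC v u).
by rewrite intrB !intrM; ring.
Qed.

Definition vertical c (l : int) : heis_sim R := heis_incl (0, l%:~R * c).

Lemma verticalD c k l : vertical c (k + l) = (vertical c k * vertical c l)%g.
Proof.
by rewrite /vertical -heis_inclM heisM area0l mulr0 !addr0 intrD mulrDl.
Qed.

Lemma vertical_inj c : c != 0 -> injective (vertical c).
Proof.
move=> c0 k l /(congr1 (fun a : heis_sim R => a.1.2)) /= /(mulIf c0) E.
exact: (@intr_inj R).
Qed.

Section Order.
Variables (w u v : R[i]) (c : R) (n : nat).
Hypotheses (c0 : 0 < c) (n0 : (0 < n)%N) (vuE : area v u = n%:R * (c / 2)).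
Let Lam := half_turn_group w u v c `&` range (@heis_incl R).

Lemma translationP a : Lam a <->
  exists m k l, a = heis_incl (trans_elt w u v c m k l).
Proof.
split; last by move=> [m [k [l ->]]]; split; [exists m, k, l; left | eexists].
move=> [[m [k [l [->|->]]]] [g _ gE]]; first by exists m, k, l.
case: (@heis_rot_neq1 R 1%g).
by move: (congr1 snd gE) => /= gE2; rewrite /heis_rot -gE2.
Qed.

(** A central translation has [area] zero against the basis, so it is
vertical. *)
Lemma center_translations : center Lam = range (vertical c).
Proof.
have vu0 : area v u != 0.
  by rewrite vuE mulf_neq0 ?pnatr_eq0 -?lt0n // gt_eqF // divr_gt0.
apply/seteqP; split => a.
  move=> [/translationP[m [k [l ->]]]] comm.
  have orth m' k' : area (lattice_pt u v m k) (lattice_pt u v m' k') = 0.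
    have /commgP : commute (heis_incl (trans_elt w u v c m k l))
                           (heis_incl (trans_elt w u v c m' k' 0)).
      by apply: comm; apply/translationP; exists m', k', 0.
    rewrite heis_commg => /eqP /(congr1 (fun a : heis_sim R => a.1.2)) /=.
    by move/eqP; rewrite mulf_eq0 pnatr_eq0 => /eqP.
  have z0 : lattice_pt u v m k = 0.
    apply: (area_nondegenerate vu0).
      by rewrite -(orth 0 1) /lattice_pt mulr0z mulr1z add0r.
    by rewrite -(orth 1 0) /lattice_pt mulr0z mulr1z addr0.
  by exists l => //; rewrite /vertical /trans_elt z0 area0r mulr0 add0r.
move=> [l _ <-]; split.
  apply/translationP; exists 0, 0, l.
  by rewrite /vertical /trans_elt /lattice_pt !mulr0z addr0 area0r mulr0 add0r.
move=> _ /translationP[m' [k' [l' ->]]]; apply/commgP/eqP.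
by rewrite heis_commg area0l mulr0.
Qed.

(** A commutator of translations has height [4 area z z'], and [area] takes on
the lattice all multiples of [area v u = n (c / 2)]. *)
Lemma commutators_translations :
  commutator_subgroup Lam = [set vertical c (m * (2 * n)%:Z) | m in setT].
Proof.
have multE (m : int) :
    vertical c (m * (2 * n)%:Z) = heis_incl (0, 4 * (m%:~R * area v u)).
  by rewrite /vertical vuE intrM PoszM intrM; congr (heis_incl (_, _)); field.
apply/seteqP; split.
  apply: generated_sub.
    split; first by exists 0; rewrite // multE mul0r mulr0.
    move=> _ _ [m _ <-] [k _ <-]; exists (m - k) => //.
    rewrite !multE -heis_inclV -heis_inclM heisV heisM area0l subrr mulr0 addr0 intrB.
    by congr (heis_incl (_, _)); ring.
  move=> _ /= [_ /translationP[m [k [l ->]]] [_ /translationP[m' [k' [l' ->]]] <-]].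
  exists (k * m' - m * k') => //.
  by rewrite heis_commg /= area_lattice_pt multE.
move=> _ [m _ <-].
apply: (@subgroup_int _ (commutator_subgroup Lam)
  (fun k => vertical c (k * (2 * n)%:Z)) m).
- exact: generated_subgroup.
- by move=> k l; rewrite mulrDl verticalD.
apply: sub_generated; exists (heis_incl (trans_elt w u v c 0 1 0)).
  by apply/translationP; exists 0, 1, 0.
exists (heis_incl (trans_elt w u v c 1 0 0)).
  by apply/translationP; exists 1, 0, 0.
by rewrite heis_commg /= area_lattice_pt multE mulr1 mulr0 subr0.
Qed.

Lemma quotient_order_translations :
  quotient_order (center Lam) (commutator_subgroup Lam) = (2 * n)%N.
Proof.
rewrite center_translations commutators_translations.
apply: quotient_order_cyclic; first exact: verticalD.
  by apply: vertical_inj; rewrite gt_eqF.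
by rewrite muln_gt0.
Qed.

End Order.

Lemma half_turn_group0P u v c a : half_turn_group 0 u v c a <-> exists m k l,
  a = heis_incl (lattice_pt u v m k, l%:~R * c) \/
  a = heis_rot (lattice_pt u v m k, c / 2 + l%:~R * c).
Proof.
by split=> -[m [k [l E]]]; exists m, k, l; move: E;
  rewrite /trans_elt /rot_elt area0l mulr0 !add0r.
Qed.

Lemma half_turn_group_subgroup u v c (n : nat) :
  area v u = n%:R * (c / 2) -> is_subgroup (half_turn_group 0 u v c).
Proof.
move=> vuE; split.
  apply/half_turn_group0P; exists 0, 0, 0; left.
  by rewrite /lattice_pt !mulr0z addr0 mul0r.
have area2E m k m' k' : 2 * area (lattice_pt u v m k) (lattice_pt u v m' k') =
    ((k * m' - m * k') * n%:Z)%:~R * c.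
  by rewrite area_lattice_pt vuE intrM; field.
have ptD m k m' k' : lattice_pt u v m k + lattice_pt u v m' k' =
    lattice_pt u v (m + m') (k + k').
  by rewrite /lattice_pt !mulrzDr addrACA.
move=> x y /half_turn_group0P[m [k [l xE]]] /half_turn_group0P[m' [k' [l' yE]]].
apply/half_turn_group0P.
case: xE yE => [->|->] [->|->].
- exists (m - m'), (k - k'), (l - l' - (k * m' - m * k') * n%:Z); left.
  rewrite -heis_inclV -heis_inclM heisV heisM areaNr mulrN area2E lattice_ptB.
  by rewrite !intrB; congr (heis_incl (_, _)); ring.
- exists (m + m'), (k + k'), (l - l' - 1 + (k * m' - m * k') * n%:Z); right.
  rewrite heis_rotV heis_incl_rot heisV /reflect_heis /= opprK heisM area2E ptD.
  by rewrite intrD !intrB; congr (heis_rot (_, _)); field.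
- exists (m + m'), (k + k'), (l - l' + (k * m' - m * k') * n%:Z); right.
  rewrite -heis_inclV heis_rot_incl heisV /reflect_heis /= opprK heisM area2E ptD.
  by rewrite intrD !intrB; congr (heis_rot (_, _)); field.
- exists (m - m'), (k - k'), (l - l' - (k * m' - m * k') * n%:Z); left.
  rewrite heis_rotV heis_rot_rot heisV /reflect_heis /= opprK heisM areaNr mulrN.
  by rewrite area2E lattice_ptB !intrB; congr (heis_incl (_, _)); field.
Qed.

(** The condition on the imaginary part makes the twist [2 area z z'] of the
product lie in [c Z] on the lattice, so that it is absorbed by the vertical
generator. *)
Lemma Gamma_tau_cE tau c (n : nat) :
  complex.Im tau = n%:R * (c / 2) -> Gamma_tau_c tau c = half_turn_group 0 1 tau c.
Proof.
move=> tauE; have tau1 : area tau 1 = n%:R * (c / 2).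
  by rewrite areaE -tauE /=; ring.
have sB := half_turn_group_subgroup tau1.
apply/seteqP; split.
  apply: generated_sub => // a [[g gA <-]|->]; last first.
    apply/half_turn_group0P; exists 0, 0, 0; right.
    by rewrite /lattice_pt !mulr0z addr0 mul0r addr0.
  suff : generated ([set (1, 0); (tau, 0); (0, c)] : set (heis R)) `<=`
      [set g : heis R | half_turn_group 0 1 tau c (heis_incl g)] by apply.
  apply: generated_sub.
    split => [|x y /= Bx By]; first exact: sB.1.
    by rewrite heis_inclM heis_inclV; apply: sB.2.
  move=> h [[->|->]|->]; apply/half_turn_group0P.
  - by exists 1, 0, 0; left; rewrite /lattice_pt mulr1z mulr0z addr0 mul0r.
  - by exists 0, 1, 0; left; rewrite /lattice_pt mulr1z mulr0z add0r mul0r.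
  - by exists 0, 0, 1; left; rewrite /lattice_pt !mulr0z addr0 mul1r.
have sG : is_subgroup (Gamma_tau_c tau c) by exact: generated_subgroup.
have Glat g : [set (1, 0); (tau, 0); (0, c)] g -> Gamma_tau_c tau c (heis_incl g).
  by move=> gA; apply: sub_generated; left; exists g => //; apply: sub_generated.
have G1 (m : int) : Gamma_tau_c tau c (heis_incl (1 *~ m, 0)).
  apply: (@subgroup_int _ _ (fun m => heis_incl (1 *~ m, 0)) m sG) => [k l|].
    by rewrite -heis_inclM heisM areaMzl areaMzr areazz !mulr0 !addr0 mulrzDr.
  by apply: Glat; left; left.
have Gt (m : int) : Gamma_tau_c tau c (heis_incl (tau *~ m, 0)).
  apply: (@subgroup_int _ _ (fun m => heis_incl (tau *~ m, 0)) m sG) => [k l|].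
    by rewrite -heis_inclM heisM areaMzl areaMzr areazz !mulr0 !addr0 mulrzDr.
  by apply: Glat; left; right.
have Gc (m : int) : Gamma_tau_c tau c (vertical c m).
  apply: (@subgroup_int _ _ (vertical c) m sG) => [k l|]; first exact: verticalD.
  by rewrite /vertical mul1r; apply: Glat; right.
have Gtr (m k l : int) :
    Gamma_tau_c tau c (heis_incl (lattice_pt 1 tau m k, l%:~R * c)).
  (* The product of (m, 0) and (k tau, 0) has height - m k n c. *)
  have := subgroupM sG (subgroupM sG (G1 m) (Gt k)) (Gc (l + m * k * n%:Z)).
  rewrite /vertical /lattice_pt -heis_inclM heisM -heis_inclM heisM.
  rewrite area0r mulr0 !addr0 add0r.
  congr (Gamma_tau_c _ _ (heis_incl (_, _))).
  by rewrite areaMzl areaMzr areaC tau1 intrD !intrM; field.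
move=> _ /half_turn_group0P[m [k [l [->|->]]]]; first exact: Gtr.
have Gphi : Gamma_tau_c tau c (heis_phi c) by apply: sub_generated; right.
have := subgroupM sG (Gtr m k l) Gphi.
rewrite [heis_phi c]/(heis_rot (0, c / 2)) heis_incl_rot heisM area0r.
by rewrite mulr0 !addr0 addrC.
Qed.

(** The translation by [w / 2] moves the centre of the half-turns to the origin
and untwists the heights; the dilation by [u] turns the basis [u], [v] into
[1], [v / u]. *)
Lemma conjugate_half_turn_group w u v c (u0 : u != 0) :
  conjugate_set (half_turn_group w u v c) ((w / 2, 0), exist _ u u0) =
  half_turn_group 0 1 (v / u) (c / ComplexField.Normc.normc u ^+ 2).
Proof.
pose a : heis_sim R := ((w / 2, 0), exist _ u u0).
set r := ComplexField.Normc.normc u ^+ 2.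
have r0 : r != 0.
  by rewrite expf_neq0 //; apply: contra_neq (u0); exact: ComplexField.Normc.eq0_normc.
have ptE m k : u * lattice_pt 1 (v / u) m k = lattice_pt u v m k.
  by rewrite /lattice_pt mulrDr !mulrzAr mulr1 [u * _]mulrC divfK.
have conjE x y : (x * a = a * y)%g -> (x ^ a)%g = y.
  by move=> E; rewrite conjgE E mulKg.
have wE y : area w y = 2 * area (w / 2) y.
  by rewrite {1}[w]splitr areaDl mulrDl mul1r.
have trE m k l : (heis_incl (trans_elt w u v c m k l) ^ a)%g =
    heis_incl (trans_elt 0 1 (v / u) (c / r) m k l).
  apply: conjE; rewrite /trans_elt area0l -ptE.
  move: (lattice_pt 1 _ m k) => z.
  rewrite /heis_incl /a; congr (_, _); last by rewrite mulg1 mul1g.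
  rewrite dilation1 /dilation /= !heisM -/r; congr (_, _); first exact: addrC.
  rewrite wE (areaC (w / 2)) /=.
  by field.
have rtE m k l : (heis_rot (rot_elt w u v c m k l) ^ a)%g =
    heis_rot (rot_elt 0 1 (v / u) (c / r) m k l).
  apply: conjE; rewrite /rot_elt -ptE add0r.
  move: (lattice_pt 1 _ m k) => z.
  rewrite /heis_rot /a; congr (_, _).
    rewrite dilation_neg1 /reflect_heis /dilation /= !heisM -/r; congr (_, _).
      by field.
    rewrite areaNr areaDl wE areazz (areaC (w / 2)) /=.
    by field.
  by apply: val_inj; rewrite /= mulrC.
apply/seteqP; split.
  move=> _ [x [m [k [l [->|->]]]] <-]; exists m, k, l; [left|right].
    exact: trE.
  exact: rtE.
move=> x [m [k [l [->|->]]]].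
  exists (heis_incl (trans_elt w u v c m k l)); first by exists m, k, l; left.
  exact: trE.
exists (heis_rot (rot_elt w u v c m k l)); first by exists m, k, l; right.
exact: rtE.
Qed.

End NormalFormFacts.

Theorem proposition5p1 (R : realType) (Gam : subgroup (heis_sim R)) :
  heis_bieberbach Gam ->
  @pr2 R @` Gam = generated [set Cstar_neg1 R] ->
  let Lam := Gam `&` range (@heis_incl R) in
  let N := quotient_order (center Lam) (commutator_subgroup Lam) in
  ~~ odd N /\
  exists tau : R[i],
    let c := 4 * complex.Im tau / N%:R in
    0 < complex.Im tau /\
    exists a : heis_sim R, conjugate_set Gam a = Gamma_tau_c tau c.
Proof.
move=> Gb G2.
have [w [u [v [c [n [c0 n0 vuE GE]]]]]] := bieberbach_normal_form Gb G2.
rewrite /= GE (quotient_order_translations _ c0 n0 vuE).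
split; first by rewrite mul2n odd_double.
have u0 : u != 0.
  apply/eqP => uE; move: vuE; rewrite uE area0r => /eqP.
  by rewrite eq_sym mulf_eq0 pnatr_eq0 -[_ == 0%N]negbK -lt0n n0 gt_eqF ?divr_gt0.
set r := ComplexField.Normc.normc u ^+ 2.
have r0 : 0 < r.
  rewrite exprn_gt0 // lt0r; apply/andP; split; last by case: (u) => x y; exact: sqrtr_ge0.
  by apply: contra_neq u0; exact: ComplexField.Normc.eq0_normc.
have ImE : complex.Im (v / u) = n%:R * (c / r / 2).
  apply: (@mulfI _ r); first by rewrite gt_eqF.
  rewrite /r -area_mulr mulrC divfK // vuE -/r; field.
  by rewrite gt_eqF.
exists (v / u); split.
  by rewrite ImE mulr_gt0 ?ltr0n // !divr_gt0.
exists ((w / 2, 0), exist _ u u0); rewrite conjugate_half_turn_group -/r.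
have -> : 4 * complex.Im (v / u) / (2 * n)%:R = c / r.
  rewrite ImE natrM; field; rewrite pnatr_eq0 -lt0n n0.
  by rewrite gt_eqF.
by rewrite (Gamma_tau_cE ImE).
Qed.
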